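(* Let $\beta_1,\beta_2,\beta_3,\ldots$ be rational numbers such that $\beta_1=1$, $\beta_2=\frac52$, and for every integer $i\ge3$: (1) $\beta_i\ge\beta_{i-1}+2$, and (2) for all $s,t\in\{2,\dots,i-2\}$ with $s+t=i$ we have $\beta_i\ge\beta_s+\beta_t+\frac{2i-1}{i}$. Let $\alpha$ be a positive integer and let $G$ be a graph on $n$ vertices with independence number at most $\alpha$. Then $G$ contains an immersion of a clique on at least $\left\lfloor\frac{n}{\beta_\alpha}\right\rfloor-1$ vertices.
   Context: A graph $G$ contains a graph $H$ as an immersion if there is an injective map $\phi\colon V(H)\to V(G)$ such that for every edge $uv\in E(H)$ there is a path $P_{uv}$ in $G$ with endpoints $\phi(u)$ and $\phi(v)$, and the paths $P_{uv}$, $uv\in E(H)$, are pairwise edge-disjoint. The independence number of $G$ is the maximum size of a set of pairwise non-adjacent vertices. *)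

(* Defs.v *)
From mathcomp Require Import all_boot.

Set Implicit Arguments.
Unset Strict Implicit.
Unset Printing Implicit Defensive.

Record sgraph := SGraph {
  vertex :> finType;
  adj : rel vertex;
  adj_sym : symmetric adj;
  adj_irrefl : irreflexive adj
}.

Lemma neq_sym (T : eqType) : symmetric (fun x y : T => x != y).
Proof. by move=> x y; rewrite eq_sym. Qed.

Lemma neq_irrefl (T : eqType) : irreflexive (fun x y : T => x != y).
Proof. by move=> x; rewrite eqxx. Qed.

Definition clique (m : nat) : sgraph :=
  @SGraph 'I_m (fun x y => x != y) (@neq_sym _) (@neq_irrefl _).

Definition edges (G : sgraph) : {set {set G}} :=
  [set [set xy.1; xy.2] | xy in [set xy : G * G | adj xy.1 xy.2]].

Definition independent (G : sgraph) (A : {set G}) : bool :=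
  [forall x in A, forall y in A, ~~ adj x y].

Definition independence_number (G : sgraph) : nat :=
  \max_(A : {set G} | independent A) #|A|.

(* A path is the nonempty sequence of its vertices, without repetition. *)
Definition path_from (G : sgraph) (x y : G) (s : seq G) : bool :=
  if s is z :: p then [&& z == x, path (@adj G) z p, last z p == y & uniq s]
  else false.

Definition path_edges (G : sgraph) (s : seq G) : seq {set G} :=
  [seq [set xy.1; xy.2] | xy <- zip s (behead s)].

(* The paths are indexed by the unordered edges of H, so the path of the edge
   {u, v} may be listed starting from either of its endpoints. *)
Definition has_immersion (G H : sgraph) : Prop :=
  exists phi : H -> G, exists P : {set H} -> seq G,
  [/\ injective phi,
      forall u v : H, adj u v ->
        path_from (phi u) (phi v) (P [set u; v])
        || path_from (phi v) (phi u) (P [set u; v])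
    & {in edges H &, forall e f, e != f ->
        ~~ has [in path_edges (P e)] (path_edges (P f))}].

(* Main.v *)
Require Import Defs.
From mathcomp Require Import all_boot all_order all_algebra.
From mathcomp Require Import zify lra.

(* Remove a maximum independent set I from G and take, by induction on n, a
   clique immersion with one branch vertex too few in G - I.  Any v0 in I can be
   added to it along edges meeting I only: every branch vertex has a neighbour
   in I, and by Hall's theorem all of them can be routed to v0 with each vertex
   outside I used at most once, unless for some partition of I into J and K
   fewer than n / beta_alpha vertices have neighbours in both parts.  In that
   case the vertices without neighbour in K, or those without neighbour in J,
   are numerous, and they have independence number at most #|J|, resp. #|K|.

   For alpha = 2, delete an induced 5-cycle v1 ... v5 instead and add v1 and v3:
   every other vertex sees at least three vertices of the cycle, so a branch
   vertex missing v1 or v3 can reach it through one helper outside the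
   immersion.  Without induced 5-cycles, the vertices at distance 0 or 2 from v
   in the complement form a clique, which leaves many vertices complete to the
   clique of non-neighbours of v unless all degrees are so large that a
   non-adjacent pair can be removed as above. *)

Set Implicit Arguments.
Unset Strict Implicit.
Unset Printing Implicit Defensive.

(** * Hall's marriage theorem *)

(** Induction on [#|D|]. If a nonempty proper subset [W] of [D] is tight, [W] and [D :\: W] are
    matched separately, the latter outside the neighbours of [W]. Otherwise every such [W] has a
    spare neighbour, so any [x] may take any [y] in [N x] and [y] can be deleted. *)
Lemma hall (T : finType) (D : {set T}) (N : T -> {set T}) :
  (forall W : {set T}, W \subset D -> #|W| <= #|\bigcup_(x in W) N x|) ->
  exists2 h : T -> T, {in D &, injective h} & {in D, forall x, h x \in N x}.
Proof.
have [n] := ubnP #|D|; elim: n D N => // n IHn D N /ltnSE leDn hallD.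
have [-> | [x xD]] := set_0Vmem D.
  by exists id => [x y|x]; rewrite inE.
have [/existsP[W /and4P[sWD W0 ltWD /eqP tightW]]|loose] :=
  boolP [exists W : {set T}, [&& W \subset D, W != set0, #|W| < #|D|
           & #|W| == #|\bigcup_(x in W) N x|]].
  set K := \bigcup_(x in W) N x in tightW.
  have [|W' sW'|h1 inj1 h1N] := IHn W N; first by lia.
    by apply: hallD; apply: subset_trans sWD.
  have [||h2 inj2 h2N] := IHn (D :\: W) (fun x => N x :\: K).
  - rewrite cardsD (setIidPr sWD).
    have : 0 < #|W| by rewrite card_gt0.
    by lia.
  - move=> W' sW'D.
    have sW'D' : W' \subset D by apply: subset_trans sW'D _; apply: subsetDl.
    have disj : [disjoint W & W'].
      rewrite disjoint_sym disjoints_subset; apply/subsetP => z /(subsetP sW'D).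
      by rewrite !inE => /andP[].
    have := hallD (W :|: W'); rewrite subUset sWD sW'D' => /(_ isT).
    rewrite cardsU (disjoint_setI0 disj) cards0 subn0.
    have sub : \bigcup_(x in W :|: W') N x \subset
        K :|: \bigcup_(x in W') (N x :\: K).
      apply/subsetP => z /bigcupP[y /setUP[yW|yW'] zN].
        by apply/setUP; left; apply/bigcupP; exists y.
      rewrite inE; case: (boolP (z \in K)) => //= zK.
      by apply/bigcupP; exists y; rewrite // inE zK.
    by have := subset_leq_card sub; rewrite cardsU; lia.
  exists (fun y => if y \in W then h1 y else h2 y).
    have cross y z : y \in W -> z \in D -> z \notin W -> h1 y <> h2 z.
      move=> yW zD zW eq; have /h2N : z \in D :\: W by rewrite inE zW.
      by rewrite inE -eq; case/andP => /negP[]; apply/bigcupP; exists y; last exact: h1N.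
    move=> y z yD zD; case: ifPn => yW; case: ifPn => zW.
    - exact: inj1.
    - by move/cross: yW => /(_ _ zD zW).
    - by move/esym/(cross _ _ zW yD yW).
    - by apply: inj2; rewrite inE ?yW ?zW.
  move=> y yD; case: ifPn => yW; first exact: h1N.
  by have /h2N : y \in D :\: W; rewrite inE ?yW // => /andP[].
have /card_gt0P[y yN] : 0 < #|N x|.
  have := hallD [set x]; rewrite sub1set xD big_set1 cards1; exact.
have [||h inj hN] := IHn (D :\ x) (fun z => N z :\ y).
- by rewrite (cardsD1 x) xD in leDn.
- move=> W sW.
  have [->|W0] := eqVneq W set0; first by rewrite cards0.
  have sWD : W \subset D by apply: subset_trans sW _; apply: subD1set.
  have ltWD : #|W| < #|D|.
    by have := subset_leq_card sW; rewrite [#|D|](cardsD1 x) xD; lia.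
  have : #|W| < #|\bigcup_(x in W) N x|.
    rewrite ltn_neqAle hallD // andbT.
    by move/existsPn: loose => /(_ W); rewrite sWD W0 ltWD.
  have sub : \bigcup_(z in W) N z \subset y |: \bigcup_(z in W) (N z :\ y).
    apply/subsetP => z /bigcupP[w wW zN]; rewrite !inE; case: eqP => //= /eqP zy.
    by apply/bigcupP; exists w; rewrite // !inE zy.
  by have := subset_leq_card sub; rewrite cardsU1; case: (y \notin _) => /=; lia.
exists (fun z => if z == x then y else h z).
  move=> z w zD wD; case: eqP => [->|/eqP zx]; case: eqP => [->|/eqP wx] // eq.
  - by have := hN w; rewrite !inE wx wD -eq eqxx => /(_ isT).
  - by have := hN z; rewrite !inE zx zD eq eqxx => /(_ isT).
  - by apply: inj; rewrite ?inE ?zx ?wx.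
move=> z zD; case: eqP => [->|/eqP zx] //.
by have := hN z; rewrite !inE zx zD => /(_ isT) /andP[].
Qed.

(** * Clique immersions as edge labellings *)

Lemma set2_inv (T : finType) (a b a' b' : T) :
  [set a; b] = [set a'; b'] -> (a = a' /\ b = b') \/ (a = b' /\ b = a').
Proof.
move=> E; have Ha : a \in [set a'; b'] by rewrite -E set21.
have Hb : b \in [set a'; b'] by rewrite -E set22.
have Ha' : a' \in [set a; b] by rewrite E set21.
have Hb' : b' \in [set a; b] by rewrite E set22.
case/set2P: Ha => ?; case/set2P: Hb => ?; case/set2P: Ha' => ?;
  by case/set2P: Hb' => ?; subst; auto.
Qed.

Definition induced (G : sgraph) (U : {set G}) (a b : G) : bool :=
  [&& a \in U, b \in U & adj a b].

(** The edges lost when [S] is deleted: a clique immersion in [U :\: S] leaves all of them free for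
    new paths. *)
Definition meeting (G : sgraph) (U S : {set G}) (a b : G) : bool :=
  induced U a b && ((a \in S) || (b \in S)).

Definition joined (G : sgraph) (E : rel G) (c : G -> G -> {set G}) (x y : G) :=
  connect [rel a b | E a b && (c a b == [set x; y])] x y.

(* A clique immersion in G[U] with branch set X: c labels each edge with the pair
   of branch vertices whose path uses it, so edge-disjointness is automatic. *)
Definition immersed (G : sgraph) (U X : {set G}) : Prop :=
  X \subset U /\ exists2 c : G -> G -> {set G}, (forall a b, c a b = c b a) &
    {in X &, forall x y, x != y -> joined (induced U) c x y}.

Lemma joined_sub (G : sgraph) (E E' : rel G) (c c' : G -> G -> {set G}) x y :
  (forall a b, E a b -> E' a b /\ c' a b = c a b) ->
  joined E c x y -> joined E' c' x y.
Proof.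
move=> sub; apply: connect_sub => a b /= /andP[/sub[E'ab cab] eqc].
by apply: connect1; rewrite /= E'ab cab.
Qed.

Lemma joined_sym (G : sgraph) (E : rel G) (c : G -> G -> {set G}) x y :
  symmetric E -> (forall a b, c a b = c b a) ->
  joined E c x y -> joined E c y x.
Proof.
move=> symE symc; rewrite /joined [[set y; x]]setUC sym_connect_sym // => a b.
by rewrite /= symE symc.
Qed.

Lemma induced_sym (G : sgraph) (U : {set G}) : symmetric (induced U).
Proof. by move=> a b; rewrite /induced adj_sym andbCA. Qed.

Lemma meeting_sym (G : sgraph) (U S : {set G}) : symmetric (meeting U S).
Proof. by move=> a b; rewrite /meeting induced_sym orbC. Qed.

Lemma immersedW (G : sgraph) (U U' X X' : {set G}) :
  U \subset U' -> X' \subset X -> immersed U X -> immersed U' X'.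
Proof.
move=> /subsetP sU sX' [sX [c symc jc]]; split.
  by apply: subset_trans sX' _; apply: subset_trans sX _; apply/subsetP.
exists c => // x y xX yX xy.
have := jc x y (subsetP sX' _ xX) (subsetP sX' _ yX) xy.
by apply: joined_sub => a b /and3P[/sU aU /sU bU ab]; rewrite /induced aU bU.
Qed.

(** Old paths avoid [S] and new ones use only edges meeting [S], so the two labellings can be glued
    without conflict. *)
Lemma immersed_extend (G : sgraph) (U S X Z : {set G}) (c : G -> G -> {set G}) :
  S \subset U -> Z \subset S -> immersed (U :\: S) X ->
  (forall a b, c a b = c b a) ->
  {in X :|: Z & Z, forall x z, x != z -> joined (meeting U S) c x z} ->
  immersed U (X :|: Z).
Proof.
move=> sSU sZS [sX [c0 symc0 jc0]] symc jc; split.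
  rewrite subUset (subset_trans sZS) // andbT.
  by apply: subset_trans sX _; apply: subsetDl.
pose c' a b := if (a \in S) || (b \in S) then c a b else c0 a b.
have symc' a b : c' a b = c' b a by rewrite /c' orbC symc symc0.
have new x z : x \in X :|: Z -> z \in Z -> x != z -> joined (induced U) c' x z.
  move=> xXZ zZ xz; apply: joined_sub (jc _ _ xXZ zZ xz) => a b /andP[-> abS].
  by rewrite /c' abS.
exists c' => // x y xXZ yXZ xy.
have [yZ|yZ] := boolP (y \in Z); first exact: new.
have [xZ|xZ] := boolP (x \in Z).
  by apply: joined_sym symc' _; [apply: induced_sym|apply: new; rewrite // eq_sym].
have xX : x \in X by move: xXZ; rewrite inE (negPf xZ) orbF.
have yX : y \in X by move: yXZ; rewrite inE (negPf yZ) orbF.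
apply: joined_sub (jc0 _ _ xX yX xy) => a b.
rewrite /induced !inE => /and3P[/andP[aS aU] /andP[bS bU] ab].
by rewrite /c' (negPf aS) (negPf bS) aU bU ab.
Qed.

Definition is_clique (G : sgraph) (K : {set G}) : bool :=
  [forall x in K, forall y in K, (x != y) ==> adj x y].

Lemma is_cliqueP (G : sgraph) (K : {set G}) :
  reflect {in K &, forall x y, x != y -> adj x y} (is_clique K).
Proof.
apply: (iffP forall_inP) => [clK x y xK yK|clK x xK].
  by move/clK: xK => /forall_inP /(_ y yK) /implyP.
by apply/forall_inP => y yK; apply/implyP; apply: clK.
Qed.

Lemma immersed0 (G : sgraph) (U : {set G}) : immersed U set0.
Proof.
split; first exact: sub0set.
by exists (fun _ _ => set0) => // x y; rewrite inE.
Qed.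

(** Each new pair is joined by a single edge, labelled by its own two ends. *)
Lemma immersed_clique_join (G : sgraph) (D K X : {set G}) :
  is_clique K -> [disjoint K & D] -> {in K & D, forall k d, adj k d} ->
  immersed D X -> immersed (K :|: D) (X :|: K).
Proof.
move=> /is_cliqueP clK disj KD immX.
have eqD : (K :|: D) :\: K = D.
  by rewrite setDUl setDv set0U; apply/setDidPl; rewrite disjoint_sym.
apply: (@immersed_extend _ _ K _ _ (fun a b => [set a; b])) => //.
- exact: subsetUl.
- by rewrite eqD.
- by move=> a b; rewrite setUC.
move=> x z xXK zK xz; apply: connect1; rewrite /= /meeting /induced zK orbT eqxx !inE zK /= !andbT.
have sXD := subsetP (proj1 immX).
case/setUP: xXK => [/sXD xD|xK]; first by rewrite xD orbT adj_sym KD.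
by rewrite xK clK.
Qed.

Lemma immersed_clique (G : sgraph) (U K : {set G}) :
  K \subset U -> is_clique K -> immersed U K.
Proof.
move=> sKU clK; have := immersed_clique_join clK _ _ (immersed0 set0).
rewrite set0U setU0 disjoints_subset setC0 subsetT => /(_ isT) h.
by apply: immersedW (h _) => // ? ? _; rewrite inE.
Qed.

(** A connection inside one label class shortens to a path without repetition. An edge shared by two
    paths has a single label, which determines the branch pair since [phi] is injective. *)
Lemma immersedP (G : sgraph) (U X : {set G}) :
  immersed U X -> has_immersion G (clique #|X|).
Proof.
case=> [_ [c symc jc]].
pose phi (i : clique #|X|) : G := enum_val i.
have phi_inj : injective phi by apply: enum_val_inj.
have phiX i : phi i \in X by apply: enum_valP.
have route (p : {set clique #|X|}) : exists s : seq G,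
    (forall u v : clique #|X|, adj u v -> p = [set u; v] ->
       path_from (phi u) (phi v) s || path_from (phi v) (phi u) s) /\
    {in path_edges s, forall f, exists a b, f = [set a; b] /\ c a b = phi @: p}.
  have [/existsP[u /existsP[v /andP[uv /eqP def_p]]]|nop] :=
    boolP [exists u : clique #|X|, exists v : clique #|X|, adj u v && (p == [set u; v])];
    last first.
    (* A set that is not an edge of the clique gets the empty sequence, which uses no edge. *)
    exists [::]; split=> // u v uv def_p; case/existsP: nop; exists u.
    by apply/existsP; exists v; rewrite uv def_p eqxx.
  have uvX : phi u != phi v by rewrite (inj_eq phi_inj).
  have /connectP[s0 path0 last0] := jc _ _ (phiX u) (phiX v) uvX.
  case/shortenP: path0 last0 => s path_s uniq_s _ last_s {s0}.
  have def_phip : phi @: p = [set phi u; phi v].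
    by rewrite def_p imsetU !imset_set1.
  exists (phi u :: s); split.
    have from_uv : path_from (phi u) (phi v) (phi u :: s).
      rewrite /path_from eqxx -last_s eqxx uniq_s !andbT /=.
      by apply: sub_path path_s => a b /= /andP[/and3P[]].
    move=> u' v' _; rewrite def_p.
    by case/set2_inv=> -[<- <-]; rewrite from_uv ?orbT.
  rewrite def_phip => f /mapP[[a b] ab_s ->]; exists a, b; split=> //.
  pose r := [rel a b | induced setT a b && (c a b == [set phi u; phi v])].
  have col z p' : path r z p' ->
      all (fun ab => c ab.1 ab.2 == [set phi u; phi v]) (zip (z :: p') p').
    by elim: p' z => //= w p' IHp z /andP[/andP[_ ->] /IHp].
  have {path_s} : path r (phi u) s.
    apply: sub_path path_s => a' b' /= /andP[/and3P[_ _ ab] ->].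
    by rewrite /induced !inE ab.
  by move/col/allP/(_ _ ab_s)/eqP.
have [P HP] := fin_all_exists route.
exists phi, P; split=> // [u v uv|p p' _ _]; first by case: (HP [set u; v]) => /(_ u v uv erefl).
apply: contra => /hasP[f fP' fP]; apply/eqP.
have [a [b [def_f cab]]] := proj2 (HP p) f fP.
have [a' [b' [def_f' cab']]] := proj2 (HP p') f fP'.
apply: (imset_inj phi_inj); rewrite -cab -cab'.
by move: def_f'; rewrite def_f => /set2_inv[] [-> ->].
Qed.

(** * Adding one branch vertex *)

Definition crossing (G : sgraph) (Y J K : {set G}) : {set G} :=
  [set y in Y | [exists i in J, adj y i] && [exists i in K, adj y i]].

Definition dominates (G : sgraph) (I Y : {set G}) : Prop :=
  {in Y, forall y, exists2 i, i \in I & adj y i}.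

(** The iterates before the [n]-th lie in [D], where [f] is meaningful, so that [iter n f x] is
    really reached from [x]. *)
Definition trail (T : finType) (f : T -> T) (D : {set T}) (x : T) (n : nat) : Prop :=
  forall k, k < n -> iter k f x \in D.

(** Injectivity on [D] peels off the last steps of both trails; since [f] never returns to [X], both
    must reach their starting points at the same moment. *)
Lemma trail_inj (T : finType) (f : T -> T) (D X : {set T}) x x' n n' :
  {in D &, injective f} -> {in D, forall y, f y \notin X} ->
  x \in X -> x' \in X -> trail f D x n -> trail f D x' n' ->
  iter n f x = iter n' f x' -> n = n' /\ x = x'.
Proof.
move=> injf fX xX x'X; elim: n n' => [|n IHn] [|n'] tr tr' //=.
- by move=> eq; case/negP: (fX _ (tr' n' (ltnSn _))); rewrite -eq.
- by move=> eq; case/negP: (fX _ (tr n (ltnSn _))); rewrite eq.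
move/(injf _ _ (tr n (ltnSn _)) (tr' n' (ltnSn _)))/IHn.
by case=> [k kn|k kn|-> ->] //; [apply: tr|apply: tr']; apply: ltnW.
Qed.

(** An orbit that never left [D] would have pairwise distinct iterates, too many for the finite type
    [T]. *)
Lemma trail_exit (T : finType) (f : T -> T) (D X : {set T}) x :
  {in D &, injective f} -> {in D, forall y, f y \notin X} -> x \in X ->
  exists2 n, trail f D x n & iter n f x \notin D.
Proof.
move=> injf fX xX.
have [/existsP[k0 k0P]|stay] :=
  boolP [exists k : 'I_#|T|.+1, iter k f x \notin D].
  have [n nP n_min] := ex_minnP (ex_intro (fun k => iter k f x \notin D) _ k0P).
  exists n => // k; apply: contraTT => /n_min; by rewrite -leqNgt.
have inj_iter : injective (fun k : 'I_#|T|.+1 => iter k f x).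
  have tr (k : 'I_#|T|.+1) : trail f D x k.
    move=> j jk; have jT : j < #|T|.+1 by apply: ltn_trans jk _.
    by move/existsPn: stay => /(_ (Ordinal jT)) /negPn.
  move=> k k' eq; apply/val_inj.
  by case: (trail_inj injf fX xX xX (tr k) (tr k') eq).
by have := leq_card _ inj_iter; rewrite card_ord ltnn.
Qed.

(* The routes from X to v0 alternate between I and its complement and, by
   Hall's theorem, use each vertex outside I at most once. *)
Lemma immersed_augment (G : sgraph) (U I X : {set G}) (v0 : G) :
  I \subset U -> dominates I (U :\: I) -> v0 \in I -> immersed (U :\: I) X ->
  (forall J : {set G}, J \subset I -> J != set0 -> v0 \notin J ->
     #|X| <= #|crossing (U :\: I) J (I :\: J)|) ->
  immersed U (X :|: [set v0]).
Proof.
move=> sIU domI v0I immX cut; set Y := U :\: I in domI immX cut.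
have sXY : X \subset Y by case: immX.
(* The vertices of [D] cannot step directly to [v0]. Such a [y] moves on to a vertex of [N y], that
   is, a non-branch vertex outside [I] sharing a neighbour in [I] with [y]. *)
pose D := [set y in Y | ~~ adj y v0].
pose N y := [set z in Y :\: X | [exists i in I, adj y i && adj z i]].
have [|f injf fN] := @hall _ D N.
  move=> W sWD; have [->|/set0Pn[w0 w0W]] := eqVneq W set0; first by rewrite cards0.
  have WD w : w \in W -> (w \in Y) && ~~ adj w v0.
    by move/(subsetP sWD); rewrite inE.
  (* Hall's condition: [J] collects the neighbours of [W] in [I], so [W] is disjoint from the
     crossing set [C]. Both lie in [X] together with the union of the [N w], and [#|X| <= #|C|], so
     this union has at least [#|W|] elements. *)
  pose J := [set i in I | [exists w in W, adj w i]].
  have J0 : J != set0.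
    have /andP[/domI[i iI w0i] _] := WD _ w0W.
    by apply/set0Pn; exists i; rewrite inE iI; apply/existsP; exists w0; rewrite w0W.
  have v0J : v0 \notin J.
    rewrite inE v0I; apply/existsPn => w; apply/negP => /andP[/WD/andP[_ /negPf->]].
    by [].
  have sJI : J \subset I by apply/subsetP => i; rewrite inE => /andP[].
  have leX := cut J sJI J0 v0J.
  set C := crossing Y J (I :\: J) in leX.
  have disj : [disjoint W & C].
    rewrite disjoints_subset; apply/subsetP => w wW; rewrite !inE.
    apply/negP => /and3P[_ _ /exists_inP[i]]; rewrite !inE => /andP[iJ iI] wi.
    by case/negP: iJ; rewrite iI; apply/exists_inP; exists w.
  have sub : W :|: C \subset X :|: \bigcup_(w in W) N w.
    apply/subsetP => y yWC; rewrite inE; case: (boolP (y \in X)) => //= yX.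
    apply/bigcupP; case/setUP: yWC => [yW|].
      exists y => //; have /andP[yY _] := WD _ yW.
      rewrite inE in_setD yX yY /=.
      by have [i iI yi] := domI _ yY; apply/exists_inP; exists i; rewrite // yi.
    rewrite inE => /and3P[yY /exists_inP[i]]; rewrite inE.
    case/andP=> iI /exists_inP[w wW wi] yi _; exists w => //.
    by rewrite inE in_setD yX yY; apply/exists_inP; exists i; rewrite // wi.
  have := subset_leq_card sub; rewrite !cardsU (disjoint_setI0 disj) cards0.
  by move: leX; clear; lia.
have fX : {in D, forall y, f y \notin X}.
  by move=> y /fN; rewrite !inE => /andP[/andP[]].
have fY : {in D, forall y, f y \in Y}.
  by move=> y /fN; rewrite !inE => /andP[/andP[]].
pose on_route x y := [exists n : 'I_#|G|.+1,
  (y == iter n f x) && [forall k : 'I_n, iter k f x \in D]].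
have on_route_inj x x' y : x \in X -> x' \in X ->
    on_route x y -> on_route x' y -> x = x'.
  move=> xX x'X /existsP[n /andP[/eqP -> /forallP tr]].
  case/existsP=> n' /andP[/eqP eq /forallP tr'].
  have [k kn|k kn|_ //] := trail_inj injf fX xX x'X _ _ eq.
    exact: (tr (Ordinal kn)).
  exact: (tr' (Ordinal kn)).
(* An edge between [Y] and [I] takes its label from its end in [Y] alone: a vertex of [Y] is on at
   most one route, while vertices of [I] may be shared. Off the routes the label is [set0], which
   belongs to no pair. *)
pose lab y := if [pick x in X | on_route x y] is Some x then [set x; v0] else set0.
have labE x y : x \in X -> on_route x y -> lab y = [set x; v0].
  rewrite /lab => xX xy; case: pickP => [x' /andP[x'X x'y]|/(_ x)].
    by rewrite (on_route_inj x' x y).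
  by rewrite /= xX xy.
pose c a b := if a \in I then lab b else lab a.
pose c' a b := if (a \in I) == (b \in I) then set0 else c a b.
have symc a b : c' a b = c' b a.
  by rewrite /c' /c; case: (a \in I); case: (b \in I).
have c'E y i : y \in Y -> i \in I -> c' y i = lab y.
  by rewrite /c' /c inE => /andP[/negPf-> _] ->.
have in_meet y i : y \in Y -> i \in I -> adj y i -> meeting U I y i.
  rewrite inE /meeting /induced => /andP[_ ->] iI ->.
  by rewrite iI (subsetP sIU) // orbT.
apply: (@immersed_extend _ _ I _ _ c') => //; first by rewrite sub1set.
move=> x z xXv /set1P-> xv0.
have xX : x \in X by move: xXv; rewrite !inE (negPf xv0) orbF.
have xY := subsetP sXY x xX.
(* The route of [x] follows [f], each step passing through a common neighbour in [I], until it
   leaves [D]; the vertex reached is adjacent to [v0]. *)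
have [n tr exit] := trail_exit injf fX xX.
have ltn : n < #|G|.+1.
  have inj_iter : injective (fun k : 'I_n => iter k f x).
    move=> k k' eq; apply/val_inj.
    have tr' (j : 'I_n) : trail f D x j.
      by move=> i ij; apply: tr; apply: ltn_trans ij _.
    by case: (trail_inj injf fX xX xX (tr' k) (tr' k') eq).
  by have := leq_card _ inj_iter; rewrite card_ord.
have routed k : k <= n -> on_route x (iter k f x).
  move=> kn; have kG : k < #|G|.+1 by apply: leq_ltn_trans kn _.
  apply/existsP; exists (Ordinal kG); rewrite eqxx; apply/forallP => j.
  by apply: tr; apply: leq_trans kn.
have inY k : k <= n -> iter k f x \in Y.
  by case: k => [|k] kn //; apply: fY; apply: tr.
pose E := [rel a b | meeting U I a b && (c' a b == [set x; v0])].
have symE : symmetric E by move=> a b; rewrite /E /= meeting_sym symc.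
have stepE k i : k <= n -> i \in I -> adj (iter k f x) i ->
    connect E (iter k f x) i.
  move=> kn iI ki; apply: connect1; rewrite /E /= in_meet ?inY // c'E ?inY //.
  by rewrite (labE x) ?routed ?eqxx.
have reach k : k <= n -> connect E x (iter k f x).
  elim: k => [|k IHk] kn; first exact: connect0.
  apply: connect_trans (IHk (ltnW kn)) _.
  have /fN := tr k kn; rewrite inE => /andP[_ /exists_inP[i iI /andP[ki fki]]].
  apply: connect_trans (stepE k i (ltnW kn) iI ki) _.
  by rewrite (sym_connect_sym symE); apply: (stepE k.+1).
apply: connect_trans (reach n (leqnn n)) _.
apply: stepE => //; move: exit; rewrite inE inY //= negbK; exact.
Qed.

(** * Independence number two *)

(** A branch vertex [x] in [D] misses exactly one of [a] and [b], namely [tgt x], and reaches it by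
    [x], [u], [h x], [tgt x]. Edges inside [S] serve the pair [a], [b]; edges from [x] to [a] or [b]
    serve their own ends; all other edges from [x] to [S], and all those from [h x] to [S], serve
    [x] and [tgt x]. *)
Lemma immersed_add2 (G : sgraph) (U S X : {set G}) (a b : G) (h : G -> G)
    (tgt := fun x => if adj x a then b else a)
    (D := [set x in X | ~~ (adj x a && adj x b)]) :
  S \subset U -> a \in S -> b \in S -> connect (induced S) a b ->
  immersed (U :\: S) X -> {in D &, injective h} ->
  {in D, forall x, [/\ adj x a || adj x b, h x \in U :\: S :\: X,
     adj (h x) (tgt x) &
     exists2 u, u \in S :\: [set a; b] & adj x u && adj (h x) u]} ->
  immersed U (X :|: [set a; b]).
Proof.
move=> sSU aS bS ab immX injh hD; have [sX _] := immX.
pose lab w s :=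
  if w \in X then (if s \in [set a; b] then [set w; s] else [set w; tgt w])
  else if [pick x in D | h x == w] is Some x then [set x; tgt x] else set0.
pose c p r := if p \in S then (if r \in S then [set a; b] else lab r p)
              else (if r \in S then lab p r else set0).
have symc p r : c p r = c r p by rewrite /c; case: (p \in S); case: (r \in S).
have cE w s : w \in U :\: S -> s \in S -> c w s = lab w s.
  by rewrite /c inE => /andP[/negPf-> _] ->.
have in_meet w s : w \in U :\: S -> s \in S -> adj w s -> meeting U S w s.
  by rewrite inE /meeting /induced => /andP[_ ->] sS ->; rewrite sS (subsetP sSU) ?orbT.
have abS : [set a; b] \subset S by rewrite subUset !sub1set aS bS.
apply: (@immersed_extend _ _ S _ _ c) => // x z xXab zab xz.
have zS := subsetP abS z zab.
have inner : joined (meeting U S) c a b.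
  apply: connect_sub ab => p r /and3P[pS rS pr]; apply: connect1.
  by rewrite /= /meeting /induced !(subsetP sSU) // pr pS /c pS rS eqxx.
have symM := @meeting_sym _ U S.
have [xab|xNab] := boolP (x \in [set a; b]).
  move: xab zab xz => /set2P[]-> /set2P[]->; rewrite ?eqxx // => _.
  exact: joined_sym.
have xX : x \in X by move: xXab; rewrite inE (negPf xNab) orbF.
have xUS := subsetP sX x xX.
have [xz1|xNz] := boolP (adj x z).
  by apply: connect1; rewrite /= in_meet // cE // /lab xX zab eqxx.
have xD : x \in D.
  by rewrite inE xX; case/set2P: zab xNz => -> /negPf->; rewrite ?andbF.
have [xab hUSX hz [u uSab /andP[xu hu]]] := hD x xD.
have def_z : z = tgt x.
  rewrite /tgt; case/set2P: zab xNz => ->; first by move/negPf->.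
  by move/negPf=> xb; move: xab; rewrite xb orbF => ->.
have [uNab uS] : u \notin [set a; b] /\ u \in S by move: uSab; rewrite inE => /andP[].
have [hX hUS] : h x \notin X /\ h x \in U :\: S by move: hUSX; rewrite inE => /andP[].
have lab_h s : lab (h x) s = [set x; z].
  rewrite /lab (negPf hX); case: pickP => [y /andP[yD /eqP/injh->]//|/(_ x)].
    by rewrite def_z.
  by rewrite xD eqxx.
pose E := [rel p r | meeting U S p r && (c p r == [set x; z])].
have xuE : E x u by rewrite /E /= in_meet // cE // /lab xX (negPf uNab) -def_z eqxx.
have uhE : E u (h x) by rewrite /E /= symM symc in_meet // cE // lab_h eqxx.
have hzE : E (h x) z by rewrite /E /= in_meet // ?def_z // cE -?def_z // lab_h eqxx.
apply: (@connect_trans _ E u); first exact: connect1.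
by apply: (@connect_trans _ E (h x)); apply: connect1.
Qed.

Definition indep_le (G : sgraph) (k : nat) (U : {set G}) : Prop :=
  forall A : {set G}, A \subset U -> independent A -> #|A| <= k.

Lemma indep_leS (G : sgraph) k (U U' : {set G}) :
  U' \subset U -> indep_le k U -> indep_le k U'.
Proof. by move=> sU kU A sA; apply: kU; apply: subset_trans sU. Qed.

Lemma indep2_adj (G : sgraph) (U : {set G}) a b c :
  indep_le 2 U -> a \in U -> b \in U -> c \in U ->
  a != b -> a != c -> b != c -> ~~ adj b c -> adj a b || adj a c.
Proof.
move=> U2 aU bU cU ab ac bc nbc; apply/negPn/negP; rewrite negb_or => /andP[nab nac].
have sA : [set a; b; c] \subset U.
  by apply/subsetP => x; rewrite !inE => /orP[/orP[]|] /eqP->.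
have iA : independent [set a; b; c].
  apply/forall_inP => x xA; apply/forall_inP => y; move: xA; rewrite !inE.
  by do 2![case/orP=> [/orP[]|] /eqP->]; rewrite ?adj_irrefl // adj_sym.
have := U2 _ sA iA.
by rewrite -setUA cardsU1 cards2 !inE negb_or ab ac bc.
Qed.

Definition nonnbrs (G : sgraph) (U : {set G}) (v : G) : {set G} :=
  [set u in U | (u != v) && ~~ adj v u].

Lemma nonnbrs_clique (G : sgraph) (U : {set G}) v :
  indep_le 2 U -> v \in U -> is_clique (nonnbrs U v).
Proof.
move=> U2 vU; apply/is_cliqueP => x y; rewrite !inE.
case/and3P=> xU xv vx /and3P[yU yv vy] xy.
apply/negPn/negP => nxy; have := indep2_adj U2 vU xU yU.
by rewrite ![v == _]eq_sym xv yv xy nxy (negPf vx) (negPf vy) => /(_ isT isT isT isT).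
Qed.

Definition five_cycle (G : sgraph) (v1 v2 v3 v4 v5 : G) : bool :=
  [&& adj v1 v2, adj v2 v3, adj v3 v4, adj v4 v5 & adj v5 v1] &&
  [&& ~~ adj v1 v3, ~~ adj v2 v4, ~~ adj v3 v5, ~~ adj v4 v1 & ~~ adj v5 v2].

Lemma five_cycle_rot (G : sgraph) (v1 v2 v3 v4 v5 : G) :
  five_cycle v1 v2 v3 v4 v5 -> five_cycle v2 v3 v4 v5 v1.
Proof.
by case/andP=> /and5P[a b c d e] /and5P[a' b' c' d' e']; apply/andP; split; apply/and5P.
Qed.

Lemma five_cycle_uniq (G : sgraph) (v1 v2 v3 v4 v5 : G) :
  five_cycle v1 v2 v3 v4 v5 -> uniq [:: v1; v2; v3; v4; v5].
Proof.
case/andP=> /and5P[a b c d e] /and5P[a' b' c' d' e'].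
have adj_neq (x y : G) : adj x y -> x != y.
  by apply: contraTneq => ->; rewrite adj_irrefl.
have sep (x y z : G) : adj x z -> ~~ adj y z -> x != y.
  by move=> xz; apply: contraNneq => <-.
rewrite /= !inE !negb_or (adj_neq _ _ a) (adj_neq _ _ b) (adj_neq _ _ c) (adj_neq _ _ d).
rewrite [v1 == v5]eq_sym (adj_neq _ _ e).
have negsym (x y : G) : ~~ adj x y -> ~~ adj y x by rewrite adj_sym.
rewrite [v1 == v3]eq_sym (sep _ _ _ c (negsym _ _ d')).
rewrite (sep _ _ _ a (negsym _ _ b')) [v2 == v4]eq_sym (sep _ _ _ d (negsym _ _ e')).
by rewrite (sep _ _ _ b (negsym _ _ c')) [v3 == v5]eq_sym (sep _ _ _ e (negsym _ _ a')).
Qed.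

(* The helpers avoid the vertices missing both v4 and v5: each remaining one that
   sees v1 (or v3) serves every branch vertex missing v1 (or v3). *)
Lemma immersed_five_cycle (G : sgraph) (U X : {set G}) (v1 v2 v3 v4 v5 : G)
    (S := [set v in [:: v1; v2; v3; v4; v5]]) :
  indep_le 2 U -> five_cycle v1 v2 v3 v4 v5 -> S \subset U ->
  immersed (U :\: S) X ->
  (forall K : {set G}, K \subset U -> is_clique K -> #|K| <= #|X|.+1) ->
  #|X| <= #|[set y in U :\: S :\: X | adj y v4 || adj y v5]| ->
  immersed U (X :|: [set v1; v3]).
Proof.
move=> U2 cyc sSU immX smallK; set Y := [set y in _ | _] => leXY.
have [sX _] := immX.
have uniqv := five_cycle_uniq cyc.
have inS v : v \in [:: v1; v2; v3; v4; v5] -> v \in S by move=> vs; rewrite /S in_set.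
have [v1S v2S v3S] : [/\ v1 \in S, v2 \in S & v3 \in S].
  by split; apply: inS; rewrite !inE eqxx ?orbT.
have [v4S v5S] : v4 \in S /\ v5 \in S.
  by split; apply: inS; rewrite !inE eqxx ?orbT.
have [/and5P[a12 a23 a34 a45 a51] /and5P[n13 n24 n35 n41 n52]] := andP cyc.
have cover w u v : w \in U :\: S -> u \in S -> v \in S -> u != v -> ~~ adj u v ->
    adj w u || adj w v.
  rewrite inE => /andP[wS wU] uS vS; apply: indep2_adj U2 _ _ _ _ _ => //.
  - exact: subsetP uS.
  - exact: subsetP vS.
  - by apply: contraNneq wS => ->.
  - by apply: contraNneq wS => ->.
move: uniqv; rewrite /= !inE !negb_or -!andbA.
case/and5P=> d12 d13 d14 d15 /and5P[d23 d24 d25 d34 /andP[d35 /andP[d45 _]]].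
have c13 w : w \in U :\: S -> adj w v1 || adj w v3 by move=> wW; apply: cover.
have c24 w : w \in U :\: S -> adj w v2 || adj w v4 by move=> wW; apply: cover.
have c35 w : w \in U :\: S -> adj w v3 || adj w v5 by move=> wW; apply: cover.
have c14 w : w \in U :\: S -> adj w v1 || adj w v4.
  by move=> wW; apply: cover; rewrite // adj_sym.
have c25 w : w \in U :\: S -> adj w v2 || adj w v5.
  by move=> wW; apply: cover; rewrite // adj_sym.
pose tgt x := if adj x v1 then v3 else v1.
pose D := [set x in X | ~~ (adj x v1 && adj x v3)].
have sYW y : y \in Y -> y \in U :\: S :\: X by rewrite inE => /andP[].
have YW y : y \in Y -> y \in U :\: S by move/sYW; rewrite inE => /andP[].
(* The non-neighbours of [v] form a clique, hence number at most [#|X|.+1], and two of them, [p] and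
   [r], lie on the cycle. *)
have miss v p r : v \in S -> p \in S -> r \in S -> p != v -> r != v -> p != r ->
    ~~ adj v p -> ~~ adj v r ->
    #|[set x in X | ~~ adj x v]| + #|[set y in Y | ~~ adj y v]| < #|X|.
  move=> vS pS rS pv rv pr vp vr; have vU := subsetP sSU v vS.
  set M1 := [set x in X | _]; set M2 := [set y in Y | _].
  have s1 : M1 :|: M2 \subset U :\: S.
    apply/subsetP => w; rewrite !in_setU => /orP[]; rewrite inE => /andP[].
      by move/(subsetP sX).
    by move/YW.
  have s2 : [set p; r] \subset S by rewrite subUset !sub1set pS.
  have disj : [disjoint M1 :|: M2 & [set p; r]].
    rewrite disjoints_subset; apply/subsetP => w /(subsetP s1); rewrite inE => /andP[wS _].
    by rewrite inE; apply: contra wS; apply: subsetP.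
  have disj12 : [disjoint M1 & M2].
    rewrite disjoints_subset; apply/subsetP => w; rewrite inE => /andP[wX _].
    by rewrite !inE wX.
  have := smallK (nonnbrs U v) _ (nonnbrs_clique U2 vU).
  have -> : nonnbrs U v \subset U by apply/subsetP => w; rewrite inE => /andP[].
  move/(_ isT); have : M1 :|: M2 :|: [set p; r] \subset nonnbrs U v.
    apply/subsetP => w; rewrite in_setU => /orP[wM|].
      have /setDP[wU wS] := subsetP s1 w wM; rewrite inE wU adj_sym.
      have -> : w != v by apply: contraNneq wS => ->.
      by case/setUP: wM; rewrite inE => /andP[].
    by case/set2P=> ->; rewrite inE (subsetP sSU) //= ?pv ?rv ?vp ?vr.
  move/subset_leq_card; rewrite cardsU (disjoint_setI0 disj) cards0 cardsU.
  by rewrite (disjoint_setI0 disj12) cards0 cards2 pr; clear; lia.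
(* Hall's condition: if all of [W] has the same target [v], the bound [miss] on the vertices missing
   [v] suffices. If both targets occur, all of [Y] is available, since each of its vertices sees
   [v1] or [v3]. *)
have [|h injh hN] := @hall _ D (fun x => [set y in Y | adj y (tgt x)]).
  move=> W sWD; set N := \bigcup_(x in W) _.
  have WX x : x \in W -> x \in X by move/(subsetP sWD); rewrite inE => /andP[].
  have sub x y : x \in W -> y \in Y -> adj y (tgt x) -> y \in N.
    by move=> xW yY yx; apply/bigcupP; exists x; rewrite // inE yY.
  have one_sided v : v \in [set v1; v3] -> (forall x, x \in W -> tgt x = v) ->
      (forall x, x \in W -> ~~ adj x v) ->
      #|[set x in X | ~~ adj x v]| + #|[set y in Y | ~~ adj y v]| < #|X| ->
      #|W| <= #|N|.
    move=> v13 tW nW leX.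
    have [->|/set0Pn[x0 x0W]] := eqVneq W set0; first by rewrite cards0.
    have : W \subset [set x in X | ~~ adj x v].
      by apply/subsetP => x xW; rewrite inE WX // nW.
    have : Y \subset N :|: [set y in Y | ~~ adj y v].
      apply/subsetP => y yY; rewrite in_setU inE yY.
      by case: (boolP (adj y v)) => yv; rewrite ?orbT // (sub x0) // tW.
    move=> /subset_leq_card sY /subset_leq_card.
    by move: sY leX leXY; rewrite cardsU; clear; lia.
  have [/forall_inP all1|/forall_inPn[x1 x1W x1v1]] := boolP [forall x in W, adj x v1].
    apply: (one_sided v3); rewrite ?set22 //.
    - by move=> x /all1; rewrite /tgt => ->.
    - by move=> x xW; move/(subsetP sWD): (xW); rewrite inE all1 //= => /andP[].
    - by apply: (miss _ v1 v5) => //; rewrite 1?eq_sym // 1?adj_sym.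
  have [/forall_inP all3|/forall_inPn[x3 x3W x3v3]] := boolP [forall x in W, ~~ adj x v1].
    apply: (one_sided v1); rewrite ?set21 //.
    - by move=> x /all3; rewrite /tgt => /negPf->.
    - by apply: (miss _ v3 v4) => //; rewrite 1?eq_sym // 1?adj_sym.
  have /subset_leq_card leYN : Y \subset N.
    apply/subsetP => y yY; have /orP[y1|y3] := c13 y (YW y yY).
      by apply: (sub x1); rewrite // /tgt (negPf x1v1).
    by apply: (sub x3); rewrite // /tgt; move: x3v3; rewrite negbK => ->.
  by apply: leq_trans leYN; apply: leq_trans leXY; apply: subset_leq_card; apply/subsetP.
apply: (immersed_add2 (S := S) (h := h)) => //.
  apply: (@connect_trans _ _ v2); apply: connect1; rewrite /induced;
  by rewrite ?v1S ?v2S ?v3S.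
move=> x xD; have := hN x xD; rewrite inE => /andP[hY htgt].
have /andP[xX nx] : (x \in X) && ~~ (adj x v1 && adj x v3) by move: xD; rewrite inE.
have xW := subsetP sX x xX; have hW := YW _ hY.
split => //; [exact: c13|exact: sYW|].
have pick u : u \in S -> u != v1 -> u != v3 -> adj x u -> adj (h x) u ->
    exists2 u, u \in S :\: [set v1; v3] & adj x u && adj (h x) u.
  by move=> uS u1 u3 xu hu; exists u; rewrite ?xu // in_setD uS !inE negb_or u1 u3.
have h45 : adj (h x) v4 || adj (h x) v5 by move: hY; rewrite inE => /andP[].
have p2 : adj x v2 -> adj (h x) v2 ->
    exists2 u, u \in S :\: [set v1; v3] & adj x u && adj (h x) u.
  by apply: pick; rewrite // eq_sym.
have p4 : adj x v4 -> adj (h x) v4 ->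
    exists2 u, u \in S :\: [set v1; v3] & adj x u && adj (h x) u.
  by apply: pick; rewrite // eq_sym.
have p5 : adj x v5 -> adj (h x) v5 ->
    exists2 u, u \in S :\: [set v1; v3] & adj x u && adj (h x) u.
  by apply: pick; rewrite // eq_sym.
(* Both [x] and [h x] see at least two of [v2], [v4], [v5], hence a common one. *)
have := c14 x xW; have := c35 x xW; have := c25 x xW; have := c24 x xW.
have := c25 _ hW; have := c24 _ hW.
move: nx h45 p2 p4 p5.
case: (adj x v1); case: (adj x v2); case: (adj x v3); case: (adj x v4); case: (adj x v5);
  case: (adj (h x) v2); case: (adj (h x) v4); case: (adj (h x) v5) => //=; auto.
Qed.

Lemma subset_of_card (T : finType) (A : {set T}) m :
  m <= #|A| -> exists2 B : {set T}, B \subset A & #|B| = m.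
Proof.
elim: m => [|m IHm] leA; first by exists set0; rewrite ?sub0set ?cards0.
have [B sBA cardB] := IHm (ltnW leA).
have /card_gt0P[x] : 0 < #|A :\: B| by rewrite cardsD (setIidPr sBA); lia.
rewrite inE => /andP[xB xA]; exists (x |: B); first by rewrite subUset sub1set xA.
by rewrite cardsU1 xB cardB.
Qed.

Lemma card_setU_disjoint (T : finType) (A B : {set T}) :
  [disjoint A & B] -> #|A :|: B| = #|A| + #|B|.
Proof. by move=> disj; rewrite cardsU (disjoint_setI0 disj) cards0 subn0. Qed.

(** The non-edges [a b], [a' b'] and [b b'] force the edges [a b'] and [a' b], lest three vertices
    be independent; [a] and [a'] are adjacent as non-neighbours of [v]. *)
Lemma five_cycle_clique (G : sgraph) (U : {set G}) v b b' a a' :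
  indep_le 2 U -> v \in U -> b \in U -> b' \in U ->
  a \in nonnbrs U v -> a' \in nonnbrs U v -> b != v -> b' != v -> adj v b -> adj v b' ->
  ~~ adj a b -> ~~ adj a' b' -> b != b' -> ~~ adj b b' ->
  five_cycle v b a' a b'.
Proof.
move=> U2 vU bU b'U aA a'A bv b'v vb vb' nab nab' bb' nbb'.
move: (aA) (a'A); rewrite !inE => /and3P[aU av nva] /and3P[a'U a'v nva'].
have sep x y : adj v x -> ~~ adj v y -> y != x by move=> vx; apply: contraNneq => ->.
have ab' : adj a b'.
  by have := indep2_adj U2 aU bU b'U (sep _ _ vb nva) (sep _ _ vb' nva) bb' nbb';
    rewrite (negPf nab).
have a'b : adj a' b.
  by have := indep2_adj U2 a'U bU b'U (sep _ _ vb nva') (sep _ _ vb' nva') bb' nbb';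
    rewrite (negPf nab') orbF.
have aa' : a' != a by apply: contraNneq nab => <-.
have a'a := is_cliqueP _ (nonnbrs_clique U2 vU) _ _ a'A aA aa'.
rewrite /five_cycle vb [adj b a']adj_sym a'b a'a ab' [adj b' v]adj_sym vb'.
by rewrite nva' [adj b a]adj_sym nab nab' [adj a v]adj_sym nva [adj b' b]adj_sym nbb'.
Qed.

Lemma immersed_indep2 (G : sgraph) (U : {set G}) q :
  indep_le 2 U -> 5 * q <= 2 * #|U| -> exists2 X, immersed U X & q <= #|X|.+1.
Proof.
have [n] := ubnP #|U|; elim: n U q => // n IHn U q /ltnSE leUn U2 leq5.
have [q1|q_gt1] := leqP q 1; first by exists set0; rewrite ?cards0 //; apply: immersed0.
have [/existsP[K /and3P[sKU clK leqK]]|bigK] :=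
  boolP [exists K : {set G}, [&& K \subset U, is_clique K & q <= #|K|.+1]].
  by exists K => //; apply: immersed_clique.
have {bigK} smallK (K : {set G}) : K \subset U -> is_clique K -> #|K|.+1 < q.
  by move=> sK clK; move/existsPn: bigK => /(_ K); rewrite sK clK -ltnNge.
(* The branch set is trimmed to exactly [m] vertices, because the counting conditions below bound
   its size from above. *)
have exact_IH (S : {set G}) m : S \subset U -> 0 < #|S| ->
    5 * m.+1 <= 2 * (#|U| - #|S|) -> exists2 X, immersed (U :\: S) X & #|X| = m.
  move=> sSU S0 lem; have cardUS : #|U :\: S| = #|U| - #|S|.
    by rewrite cardsD (setIidPr sSU).
  have := subset_leq_card sSU => leSU.
  have [|||X immX leX] := IHn (U :\: S) m.+1.
  - by rewrite cardUS; move: leUn leSU S0; clear; lia.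
  - by apply: indep_leS U2; apply: subsetDl.
  - by rewrite cardUS.
  have [X' sX'X cardX'] := subset_of_card (leX : m <= #|X|).
  by exists X' => //; apply: immersedW immX.
have /card_gt0P[v0 v0U] : 0 < #|U| by move: leq5 q_gt1; clear; lia.
have q_gt2 : 2 < q.
  have := smallK [set v0]; rewrite sub1set cards1; apply => //.
  by apply/is_cliqueP => x y /set1P-> /set1P->; rewrite eqxx.
have [/existsP[v1 /existsP[v2 /existsP[v3 /existsP[v4 /existsP[v5 /andP[cyc sSU]]]]]]|no_cycle] :=
  boolP [exists v1, exists v2, exists v3, exists v4, exists v5,
    five_cycle v1 v2 v3 v4 v5 && ([set v in [:: v1; v2; v3; v4; v5]] \subset U)].
  set S := [set v in _] in sSU.
  have uniqv := five_cycle_uniq cyc.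
  have cardS : #|S| = 5 by rewrite cardsE; apply/card_uniqP: uniqv.
  (* Deleting five vertices lowers the attainable [q] by two: [q - 3] branch vertices remain, and
     two new ones restore [q - 1]. *)
  have [||X immX cardX] := exact_IH S (q - 3) sSU; rewrite ?cardS //.
    by move: leq5 q_gt2; clear; lia.
  have [sX _] := immX.
  have smallKX (K : {set G}) : K \subset U -> is_clique K -> #|K| <= #|X|.+1.
    by move=> sK clK; have := smallK K sK clK; rewrite cardX; move: q_gt2; clear; lia.
  set Y := U :\: S :\: X.
  have cardY : #|Y| = #|U| - 5 - (q - 3).
    by rewrite cardsD (setIidPr sX) cardsD (setIidPr sSU) cardS cardX.
  have finish a b : a \in S -> b \in S -> a != b -> immersed U (X :|: [set a; b]) ->
      exists2 X, immersed U X & q <= #|X|.+1.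
    move=> aS bS ab imm; exists (X :|: [set a; b]) => //.
    rewrite card_setU_disjoint ?cards2 ?ab ?cardX; first by move: q_gt2; clear; lia.
    rewrite disjoint_sym disjoints_subset; apply/subsetP => w wab; rewrite in_setC.
    apply/negP => /(subsetP sX); rewrite in_setD => /andP[/negP wS _]; apply: wS.
    by case/set2P: wab => ->.
  have inS v : v \in [:: v1; v2; v3; v4; v5] -> v \in S by move=> vs; rewrite /S in_set.
  have try w1 w2 w3 w4 w5 : five_cycle w1 w2 w3 w4 w5 ->
      [:: v1; v2; v3; v4; v5] =i [:: w1; w2; w3; w4; w5] ->
      #|X| <= #|[set y in Y | adj y w4 || adj y w5]| ->
      exists2 X, immersed U X & q <= #|X|.+1.
    move=> cyc' eqvw leX; have defS : S = [set w in [:: w1; w2; w3; w4; w5]].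
      by apply/setP => w; rewrite !in_set eqvw.
    have uniqw := five_cycle_uniq cyc'.
    apply: (finish w1 w3); try by apply: inS; rewrite eqvw !inE eqxx ?orbT.
      by move: uniqw; rewrite /= !inE !negb_or => /andP[/and4P[]].
    apply: (immersed_five_cycle U2 cyc'); rewrite -?defS //.
  have cyc2 := five_cycle_rot cyc; have cyc3 := five_cycle_rot cyc2.
  have perm2 : [:: v1; v2; v3; v4; v5] =i [:: v2; v3; v4; v5; v1].
    by move=> w; rewrite !inE; do 5!case: (w == _).
  have perm3 : [:: v1; v2; v3; v4; v5] =i [:: v3; v4; v5; v1; v2].
    by move=> w; rewrite !inE; do 5!case: (w == _).
  (* No vertex of Y misses two of the pairs {v4,v5}, {v5,v1}, {v1,v2}, so one of
     these pairs is missed by at most a third of Y. *)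
  have [le45|lt45] := leqP #|X| #|[set y in Y | adj y v4 || adj y v5]|.
    exact: (try _ _ _ _ _ cyc).
  have [le51|lt51] := leqP #|X| #|[set y in Y | adj y v5 || adj y v1]|.
    exact: (try _ _ _ _ _ cyc2).
  have [le12|lt12] := leqP #|X| #|[set y in Y | adj y v1 || adj y v2]|.
    exact: (try _ _ _ _ _ cyc3).
  have [_ /and5P[_ _ _ n41 n52]] := andP cyc.
  have cover y u v : y \in Y -> u \in S -> v \in S -> u != v -> ~~ adj u v ->
      adj y u || adj y v.
    rewrite !in_setD => /and3P[_ yS yU] uS vS; apply: indep2_adj U2 _ _ _ _ _ => //.
    - exact: subsetP uS.
    - exact: subsetP vS.
    - by apply: contraNneq yS => ->.
    - by apply: contraNneq yS => ->.
  have [v1S v2S v4S v5S] : [/\ v1 \in S, v2 \in S, v4 \in S & v5 \in S].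
    by split; apply: inS; rewrite !inE eqxx ?orbT.
  have c41 y : y \in Y -> adj y v4 || adj y v1.
    move=> yY; apply: cover => //.
    by rewrite eq_sym; move: uniqv; rewrite /= !inE !negb_or => /andP[/and4P[]].
  have c52 y : y \in Y -> adj y v5 || adj y v2.
    move=> yY; apply: cover => //.
    by rewrite eq_sym; move: uniqv; rewrite /= !inE !negb_or => /and3P[_ /and3P[]].
  pose M u v := [set y in Y | ~~ (adj y u || adj y v)].
  have inM y u v : (y \in M u v) = (y \in Y) && ~~ (adj y u || adj y v).
    by rewrite [LHS]inE.
  have splitY u v : #|[set y in Y | adj y u || adj y v]| + #|M u v| = #|Y|.
    rewrite -card_setU_disjoint.
      apply: eq_card => y; rewrite !inE -andb_orr orbN andbT; exact: erefl.
    rewrite disjoints_subset; apply/subsetP => y.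
    by rewrite !inE => /andP[-> ->].
  have disj1 : [disjoint M v4 v5 & M v5 v1].
    rewrite disjoints_subset; apply/subsetP => y; rewrite in_setC !inM.
    case/andP=> yY; rewrite yY /=; have := c41 y yY.
    by case: (adj y v4); case: (adj y v1); case: (adj y v5).
  have disj2 : [disjoint M v4 v5 :|: M v5 v1 & M v1 v2].
    rewrite disjoints_subset; apply/subsetP => y; rewrite in_setC in_setU !inM.
    rewrite -andb_orr; case/andP=> yY; rewrite yY /=; have := c41 y yY; have := c52 y yY.
    by case: (adj y v4); case: (adj y v1); case: (adj y v5); case: (adj y v2).
  have sMY : M v4 v5 :|: M v5 v1 :|: M v1 v2 \subset Y.
    by apply/subsetP => y; rewrite !in_setU !inM -!andb_orr => /andP[].
  have := subset_leq_card sMY; rewrite (card_setU_disjoint disj2) (card_setU_disjoint disj1).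
  have := splitY v4 v5; have := splitY v5 v1; have := splitY v1 v2.
  move: lt45 lt51 lt12 leq5 q_gt2; rewrite cardY cardX; clear; lia.
have [v vU v_max] := arg_maxnP (fun w => #|nonnbrs U w|) v0U.
have {}vU : v \in U := vU.
set A := nonnbrs U v in v_max.
have {}v_max w : w \in U -> #|nonnbrs U w| <= #|A| by move/v_max.
(* [B] is the set of vertices at distance 2 from [v] in the complement. Two non-adjacent ones would
   yield an induced 5-cycle. *)
pose B := [set b in U | [&& b != v, adj v b & [exists a in A, ~~ adj a b]]].
have sAU : A \subset U by apply/subsetP => w; rewrite inE => /andP[].
have sBU : B \subset U by apply/subsetP => w; rewrite inE => /andP[].
have clB : is_clique (v |: B).
  apply/is_cliqueP => x y; rewrite in_setU1 in_setU1.
  case/predU1P=> [->|xB]; case/predU1P=> [->|yB]; rewrite ?eqxx //.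
  - by move: yB; rewrite inE => /and4P[].
  - by move: xB; rewrite inE adj_sym => /and4P[].
  move: xB yB; rewrite !inE => /and4P[xU xv vx /exists_inP[a aA nax]].
  case/and4P=> yU yv vy /exists_inP[a' a'A nay] xy; apply/negPn/negP => nxy.
  have cyc := five_cycle_clique U2 vU xU yU aA a'A xv yv vx vy nax nay xy nxy.
  case/negP: no_cycle; apply/existsP; exists v; apply/existsP; exists x.
  apply/existsP; exists a'; apply/existsP; exists a; apply/existsP; exists y.
  rewrite cyc; apply/subsetP => w; rewrite !inE.
  by move=> /predU1P[->//|/predU1P[->//|/predU1P[->|/predU1P[->|/eqP->//]]]];
    apply: (subsetP sAU).
have vB : v \notin B by rewrite inE eqxx andbF.
have smallB : #|B|.+2 < q.
  have : #|v |: B|.+1 < q by apply: smallK clB; rewrite subUset sub1set vU.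
  by rewrite cardsU1 vB.
(* What is left is complete to [A], so all of [A] can be added to a clique immersion in [D]. *)
set D := U :\: (A :|: (v |: B)).
have AvB : [disjoint A & v |: B].
  rewrite disjoints_subset; apply/subsetP => w; rewrite !inE => /and3P[_ wv nvw].
  by rewrite (negPf wv) (negPf nvw) !andbF.
have cardD : #|D| = #|U| - (#|A| + #|B|.+1).
  have s : A :|: (v |: B) \subset U by rewrite !subUset sAU sub1set vU sBU.
  by rewrite cardsD (setIidPr s) card_setU_disjoint // cardsU1 vB.
have leABU : #|A| + #|B|.+1 <= #|U|.
  have s : A :|: (v |: B) \subset U by rewrite !subUset sAU sub1set vU sBU.
  by have := subset_leq_card s; rewrite card_setU_disjoint // cardsU1 vB.
have [|||X immX leX] := IHn D (2 * #|D| %/ 5).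
- by rewrite cardD; move: leUn leABU; clear; lia.
- by apply: indep_leS U2; apply: subsetDl.
- by rewrite mulnC leq_trunc_div.
have disjAD : [disjoint A & D].
  by rewrite disjoints_subset; apply/subsetP => w wA; rewrite in_setC in_setD in_setU wA.
have joinAD : {in A & D, forall a d, adj a d}.
  move=> a d aA; rewrite in_setD !in_setU !negb_or in_set1 => /andP[/and3P[dA dv dB] dU].
  apply/negPn/negP => nad; case/negP: dB; rewrite inE dU dv /=.
  move: dA; rewrite inE dU dv /= negbK => -> /=.
  by apply/exists_inP; exists a.
have immAX := immersed_clique_join (nonnbrs_clique U2 vU) disjAD joinAD immX.
have [leqAX|ltAX] := leqP q (#|A| + #|X|).+1.
  exists (X :|: A); first by apply: immersedW immAX; rewrite // subUset sAU subsetDl.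
  rewrite card_setU_disjoint; first by rewrite addnC.
  have [sXD _] := immX; apply: disjointWl sXD _; by rewrite disjoint_sym.
(* If this immersion is too small, then so is [A], and by the choice of [v] no vertex has more than
   [#|A|] non-neighbours. *)
have small_deg : 2 * #|A| + q <= #|U| + 2.
  by move: ltAX leX smallB leABU leq5; rewrite cardD; clear; lia.
have [A0|/set0Pn[u uA]] := eqVneq A set0.
  have clU : is_clique U.
    apply/is_cliqueP => x y xU yU xy; apply/negPn/negP => nxy.
    have := v_max x xU; rewrite A0 cards0 leqn0 cards_eq0 => /eqP/setP/(_ y).
    by rewrite !inE yU eq_sym xy nxy.
  by have := smallK U (subxx _) clU; move: leq5 q_gt2; clear; lia.
move: (uA); rewrite inE => /and3P[uU uv nvu].
have sI : [set v; u] \subset U by rewrite subUset !sub1set vU.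
have [||X' immX' cardX'] := exact_IH [set v; u] (q - 2) sI; rewrite ?cards2 1?eq_sym ?uv //.
  by move: leq5 q_gt2; clear; lia.
exists (X' :|: [set v]); last first.
  rewrite card_setU_disjoint ?cards1 ?cardX'; first by move: q_gt2; clear; lia.
  have [sX' _] := immX'; rewrite disjoint_sym disjoints_subset sub1set in_setC.
  by apply/negP => /(subsetP sX'); rewrite !inE eqxx.
apply: (immersed_augment (I := [set v; u])); rewrite ?set21 //.
  move=> y; rewrite !inE negb_or => /andP[/andP[yv yu] yU].
  have := indep2_adj U2 yU vU uU yv yu; rewrite eq_sym => /(_ uv nvu).
  by case/orP => [yv'|yu']; [exists v|exists u]; rewrite // !inE eqxx ?orbT.
move=> J sJ J0 vJ.
have defJ : J = [set u].
  apply/eqP; rewrite eqEsubset sub1set; have [w wJ] := set0Pn _ J0.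
  have only x : x \in J -> x = u.
    by move=> xJ; case/set2P: (subsetP sJ x xJ) => // def_x; rewrite -def_x xJ in vJ.
  by rewrite -{2}(only w wJ) wJ andbT; apply/subsetP => x /only->; rewrite set11.
(* A vertex seeing both [u] and [v] is crossing, so at least [#|U| - 2 * #|A|] vertices are, which
   is at least [q - 2], the size of [X']. *)
have sub : U \subset A :|: nonnbrs U u :|: crossing (U :\: [set v; u]) J ([set v; u] :\: J).
  apply/subsetP => y yU; rewrite !in_setU; case: (boolP (y \in A)) => //= yA.
  case: (boolP (y \in nonnbrs U u)) => //= yN.
  move: yA yN; rewrite !inE yU /= !negb_and !negbK.
  have [->|yv] /= := eqVneq y v; first by rewrite eq_sym (negPf uv) adj_sym (negPf nvu).
  have [->|yu] /= := eqVneq y u; first by rewrite (negPf nvu).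
  move=> vy uy; apply/andP; split; apply/exists_inP.
    by exists u; rewrite 1?adj_sym // defJ set11.
  by exists v; rewrite 1?adj_sym // in_setD set21 defJ in_set1 eq_sym uv.
have := leq_trans (subset_leq_card sub) (leq_card_setU _ _).1.
have := (leq_card_setU A (nonnbrs U u)).1; have := v_max u uU.
by move: small_deg q_gt2; rewrite cardX'; clear; lia.
Qed.

(** * Arbitrary independence number *)

Import Order.TTheory GRing.Theory Num.Theory.
Local Open Scope ring_scope.

(* The vertices of U outside I :\: J without neighbour there; if I is a maximum
   independent set, an independent set of such vertices can replace J in I. *)
Definition private (G : sgraph) (U I J : {set G}) : {set G} :=
  [set u in U :\: (I :\: J) | [forall i in I :\: J, ~~ adj u i]].

(** An independent set of private vertices stays independent when [I :\: J] is added, and that set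
    has [k - #|J|] elements. *)
Lemma private_indep_le (G : sgraph) (U I J : {set G}) k :
  indep_le k U -> I \subset U -> J \subset I -> independent I -> #|I| = k ->
  indep_le #|J| (private U I J).
Proof.
move=> Uk sIU sJI indI cardI A sA indA.
have AP a : a \in A -> [/\ a \in U, a \notin I :\: J &
    forall i, i \in I :\: J -> ~~ adj a i].
  move/(subsetP sA); rewrite inE in_setD => /andP[/andP[aIJ aU] /forall_inP nadj].
  by split.
have disj : [disjoint A & I :\: J].
  by rewrite disjoints_subset; apply/subsetP => a /AP[_ aIJ _]; rewrite in_setC.
have sAI : A :|: (I :\: J) \subset U.
  apply/subsetP => a /setUP[/AP[]//|]; rewrite inE => /andP[_]; exact: subsetP.
have indAI : independent (A :|: (I :\: J)).
  apply/forall_inP => x xAI; apply/forall_inP => y yAI.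
  case/setUP: xAI => [xA|xI]; case/setUP: yAI => [yA|yI].
  - by move/forall_inP: indA => /(_ x xA)/forall_inP/(_ y yA).
  - by have [_ _ ->] := AP x xA.
  - by rewrite adj_sym; have [_ _ ->] := AP y yA.
  move: xI yI; rewrite !inE => /andP[_ xI] /andP[_ yI].
  by move/forall_inP: indI => /(_ x xI)/forall_inP/(_ y yI).
have := Uk _ sAI indAI; rewrite card_setU_disjoint // cardsD (setIidPr sJI) cardI.
by have := subset_leq_card sJI; rewrite cardI; clear; lia.
Qed.

(** A vertex outside [I] that is not crossing has no neighbour in one of the two parts; a vertex of
    [I] is private to its own part. *)
Lemma private_cover (G : sgraph) (U I J : {set G}) :
  J \subset I -> independent I ->
  (#|U| <= #|private U I J| + #|private U I (I :\: J)|
           + #|crossing (U :\: I) J (I :\: J)|)%N.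
Proof.
move=> sJI indI; have JJ : I :\: (I :\: J) = J by rewrite setDDr setDv set0U; apply/setIidPr.
have nI x y : x \in I -> y \in I -> ~~ adj x y.
  by move=> xI yI; move/forall_inP: indI => /(_ x xI)/forall_inP/(_ y yI).
have sub : U \subset private U I J :|: private U I (I :\: J) :|: crossing (U :\: I) J (I :\: J).
  apply/subsetP => u uU; rewrite !in_setU.
  have [uI|uI] := boolP (u \in I).
    apply/orP; left; have [uJ|uJ] := boolP (u \in J).
      apply/orP; left; rewrite inE in_setD uU in_setD uJ /=.
      by apply/forall_inP => i; rewrite in_setD => /andP[_]; apply: nI.
    apply/orP; right; rewrite inE in_setD uU JJ uJ /=.
    by apply/forall_inP => i /(subsetP sJI); apply: nI.
  have uJ : u \notin J by apply: contra uI; apply: subsetP.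
  rewrite ![u \in private _ _ _]inE ![u \in U :\: _]in_setD JJ uU uJ in_setD (negPf uI) andbF /=.
  rewrite inE in_setD uI uU /=.
  case: (boolP [forall i in I :\: J, _]) => //= /forall_inPn[i iIJ]; rewrite negbK => ui.
  case: (boolP [forall i in J, _]) => //= /forall_inPn[j jJ]; rewrite negbK => uj.
  by apply/andP; split; apply/exists_inP; [exists j|exists i].
apply: leq_trans (subset_leq_card sub) _.
apply: leq_trans (leq_card_setU _ _).1 _.
by rewrite leq_add2r (leq_card_setU _ _).1.
Qed.

(** Outer induction on [k], inner induction on [#|U|]; [k] equal to 1 or 2 is settled directly. *)
Lemma immersed_indep (beta : nat -> rat) (G : sgraph) (k : nat) (U : {set G}) (q : nat) :
  beta 1%N = 1 -> beta 2%N = 5 / 2 ->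
  (forall i, (3 <= i)%N -> beta i.-1 + 2 <= beta i) ->
  (forall s t, (2 <= s)%N -> (2 <= t)%N -> beta s + beta t + 1 <= beta (s + t)%N) ->
  (0 < k)%N -> indep_le k U -> q%:R * beta k <= #|U|%:R ->
  exists2 X, immersed U X & (q <= #|X|.+1)%N.
Proof.
move=> beta1 beta2 beta_step beta_split.
have beta_ge i : (0 < i)%N -> i%:R <= beta i.
  elim: i => [//|[_ _|[_ _|i IHi _]]]; rewrite ?beta1 ?beta2 //.
  by have := beta_step i.+3 isT; have := IHi isT; rewrite -natr1 /=; lra.
(* Parts of size one are covered as well: there [beta 1 + 1 = 2] is the increment in the step
   condition. *)
have beta_gap s t : (0 < s)%N -> (0 < t)%N -> (3 <= s + t)%N ->
    beta s + beta t + 1 <= beta (s + t)%N.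
  case: s => [//|[|s]]; case: t => [//|[|t]] // _ _ st.
  - by have := beta_step (1 + t.+2)%N st; rewrite beta1 /=; lra.
  - by have := beta_step (s.+2 + 1)%N st; rewrite beta1 addn1 /=; lra.
  - exact: beta_split.
elim/ltn_ind: k U q => k IHk U q k0.
have [n] := ubnP #|U|; elim: n U q => // n IHn U q /ltnSE leUn Uk leq.
have [q1|q_gt1] := leqP q 1; first by exists set0; rewrite ?cards0 //; apply: immersed0.
have [k1|k_neq1] := eqVneq k 1%N.
  exists U; last by move: leq; rewrite k1 beta1 mulr1 ler_nat; lia.
  apply: immersed_clique => //; apply/is_cliqueP => x y xU yU xy.
  apply/negPn/negP => nxy; have := Uk [set x; y]; rewrite k1 cards2 xy subUset !sub1set xU yU.
  move/(_ isT); rewrite ltnn => impossible; apply: notF; apply: impossible.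
  apply/forall_inP => a /set2P[]->; apply/forall_inP => b /set2P[]->;
    by rewrite ?adj_irrefl // adj_sym.
have [k2|k_neq2] := eqVneq k 2%N.
  apply: immersed_indep2; first by rewrite -k2.
  by rewrite -(ler_nat rat) !natrM; move: leq; rewrite k2 beta2; lra.
have k3 : (3 <= k)%N by case: k k0 k_neq1 k_neq2 {IHk IHn Uk leq} => [|[|[]]].
have ind0 : (set0 \subset U) && independent (set0 : {set G}).
  by rewrite sub0set; apply/forall_inP => x; rewrite inE.
have [I /andP[sIU indI] maxI] :=
  arg_maxnP (P := fun A : {set G} => (A \subset U) && independent A) (fun A => #|A|) ind0.
have {}maxI (A : {set G}) : A \subset U -> independent A -> (#|A| <= #|I|)%N.
  by move=> sAU indA; apply: maxI; rewrite sAU.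
have [ltI|geI] := ltnP #|I| k.
  apply: (IHk k.-1); rewrite ?ltn_predL //; first by move: k3; clear; lia.
    by move=> A sAU indA; have := maxI A sAU indA; move: ltI; clear; lia.
  apply: le_trans leq; rewrite ler_wpM2l //.
  by have := beta_step k k3; lra.
have cardI : #|I| = k by apply/eqP; rewrite eqn_leq geI Uk.
have domI : dominates I (U :\: I).
  move=> y; rewrite inE => /andP[yI yU]; apply/exists_inP; apply: contraT => /exists_inPn nadj.
  have : (#|y |: I| <= #|I|)%N.
    apply: maxI; first by rewrite subUset sub1set yU.
    apply/forall_inP => a /setU1P[->|aI]; apply/forall_inP => b /setU1P[->|bI].
    - by rewrite adj_irrefl.
    - exact: nadj.
    - by rewrite adj_sym nadj.
    - by move/forall_inP: indI => /(_ a aI)/forall_inP/(_ b bI).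
  by rewrite cardsU1 yI ltnn.
have sub_lt (J : {set G}) : J \subset I -> J != I -> (#|J| < k)%N.
  by move=> sJI JI; rewrite -cardI; apply: proper_card; rewrite properEneq JI.
(* A private set that is large for its smaller independence number already contains the desired
   clique immersion. *)
have [/existsP[J /and4P[sJI J0 JI leJ]]|small] :=
  boolP [exists J : {set G}, [&& J \subset I, J != set0, J != I &
           q%:R * beta #|J| <= #|private U I J|%:R]].
  have [||||X immX leX] := IHk #|J| _ (private U I J) q.
  - exact: sub_lt.
  - by rewrite card_gt0.
  - exact: private_indep_le cardI.
  - exact: leJ.
  exists X => //; apply: immersedW immX => //.
  by apply/subsetP => u; rewrite inE in_setD => /andP[/andP[]].
have {}small (J : {set G}) : J \subset I -> J != set0 -> J != I ->
    #|private U I J|%:R < q%:R * beta #|J|.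
  by move=> sJ J0 JI; move/existsPn: small => /(_ J); rewrite sJ J0 JI /= ltNge.
(* Both private sets are now small, so the gap of 1 in [beta], multiplied by [q], must be filled by
   crossing vertices. *)
have crossJ (J : {set G}) : J \subset I -> J != set0 -> J != I ->
    (q <= #|crossing (U :\: I) J (I :\: J)|)%N.
  move=> sJ J0 JI; rewrite -(ler_nat rat).
  have cardIJ : #|I :\: J| = (k - #|J|)%N by rewrite cardsD (setIidPr sJ) cardI.
  have ltJ := sub_lt J sJ JI; have J_gt0 : (0 < #|J|)%N by rewrite card_gt0.
  have IJ0 : I :\: J != set0 by rewrite -card_gt0 cardIJ subn_gt0.
  have IJI : I :\: J != I.
    by apply/eqP => eqIJ; move: cardIJ; rewrite eqIJ cardI; move: ltJ J_gt0; clear; lia.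
  have lt1 := small J sJ J0 JI; have lt2 := small _ (subsetDl I J) IJ0 IJI.
  have := private_cover U sJ indI; rewrite -(ler_nat rat) !natrD => cover.
  have gap : beta #|J| + beta #|I :\: J| + 1 <= beta k.
    have := beta_gap #|J| (k - #|J|)%N J_gt0.
    by rewrite cardIJ subn_gt0 (subnKC (ltnW ltJ)) => /(_ ltJ k3).
  have : q%:R * (beta #|J| + beta #|I :\: J| + 1) <= q%:R * beta k by rewrite ler_wpM2l.
  rewrite !mulrDr mulr1; move: lt1 lt2 cover leq; clear; lra.
have I_gt0 : (0 < #|I|)%N by rewrite cardI.
have /card_gt0P[v0 v0I] := I_gt0.
have cardUI : #|U :\: I| = (#|U| - k)%N by rewrite cardsD (setIidPr sIU) cardI.
have leIU : (k <= #|U|)%N by rewrite -cardI subset_leq_card.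
(* Deleting [I] costs [k] vertices, at most [beta k], so [q] drops by one only. This gives [q - 2]
   branch vertices, and [v0] is the missing one. *)
have [|||X0 immX0 leX0] := IHn (U :\: I) q.-1.
- by rewrite cardUI; move: leUn leIU k0; clear; lia.
- by apply: indep_leS Uk; apply: subsetDl.
- rewrite cardUI natrB //; have := beta_ge k k0.
  have : q.-1%:R = q%:R - 1 :> rat by rewrite -subn1 natrB // ltnW.
  by move=> ->; rewrite mulrBl mul1r; move: leq; clear; lra.
have [X sXX0 cardX] := @subset_of_card _ X0 (q - 2) ltac:(move: leX0; clear; lia).
have immX : immersed (U :\: I) X by apply: immersedW immX0.
exists (X :|: [set v0]); last first.
  rewrite card_setU_disjoint ?cards1 ?cardX; first by move: q_gt1; clear; lia.
  have [sX _] := immX; rewrite disjoint_sym disjoints_subset sub1set in_setC.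
  by apply/negP => /(subsetP sX); rewrite inE v0I.
apply: (immersed_augment (I := I)) => // J sJI J0 v0J.
apply: leq_trans (crossJ J sJI J0 _); first by rewrite cardX leq_subr.
by apply: contraNneq v0J => ->.
Qed.

(** * From the multiplicative bound to the floor of the quotient *)

Theorem theorem3p2 (beta : nat -> rat)
  (beta1 : beta 1%N = 1)
  (beta2 : beta 2%N = 5 / 2)
  (beta_step : forall i : nat, (3 <= i)%N -> beta (i - 1)%N + 2 <= beta i)
  (beta_split : forall i : nat, (3 <= i)%N ->
     forall s t : nat, (2 <= s <= i - 2)%N -> (2 <= t <= i - 2)%N ->
     (s + t = i)%N ->
     beta s + beta t + (2 * i%:R - 1) / i%:R <= beta i)
  (alpha : nat) (alpha_gt0 : (0 < alpha)%N)
  (n : nat) (G : sgraph) (card_G : #|G| = n)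
  (indep_G : (independence_number G <= alpha)%N) :
  exists m : nat,
    Num.floor (n%:R / beta alpha) - 1 <= m%:Z /\ has_immersion G (clique m).
Proof.
have step i : (3 <= i)%N -> beta i.-1 + 2 <= beta i by rewrite -subn1; apply: beta_step.
have split s t : (2 <= s)%N -> (2 <= t)%N -> beta s + beta t + 1 <= beta (s + t)%N.
  move=> s2 t2; have st_gt0 : (0 : rat) < (s + t)%:R by rewrite ltr0n; lia.
  have := beta_split (s + t)%N ltac:(lia) s t ltac:(lia) ltac:(lia) erefl.
  (* The quotient equals 2 - 1/i with i = s + t, so it is at least 1. *)
  have : (1 : rat) <= (2 * (s + t)%:R - 1) / (s + t)%:R.
    rewrite ler_pdivlMr // mul1r.
    have : (1 : rat) <= (s + t)%:R by rewrite ler1n; lia.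
    by lra.
  by lra.
have beta_gt0 i : (0 < i)%N -> 0 < beta i.
  elim: i => [//|[_ _|[_ _|i IHi _]]]; rewrite ?beta1 ?beta2 //.
  by have := step i.+3 isT; have := IHi isT; rewrite /=; lra.
have quot_ge0 : 0 <= n%:R / beta alpha.
  by rewrite divr_ge0 // ltW // beta_gt0.
have floor_ge0 : 0 <= Num.floor (n%:R / beta alpha) by rewrite floor_ge0.
(* Here [q] is the floor itself, turned into a natural number; the successor in the bound on [#|X|]
   accounts for the subtracted 1. *)
have [||X immX leX] := @immersed_indep beta G alpha setT `|Num.floor (n%:R / beta alpha)|%N
  beta1 beta2 step split alpha_gt0.
- by move=> A _ indA; apply: leq_trans indep_G; apply: (leq_bigmax_cond _ indA).
- rewrite cardsT card_G -ler_pdivlMr ?beta_gt0 // natr_absz ger0_norm //.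
  exact: floor_le.
exists #|X|; split; last exact: immersedP immX.
have : (`|Num.floor (n%:R / beta alpha)|%N : int) <= #|X|.+1%:Z by rewrite lez_nat.
by rewrite gez0_abs //; lia.
Qed.
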